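(* Let $N\ge 1$. (i) Let $\mathcal{G}_N$ be the $N$-untwisted-petal flower. Then its Bollobás–Riordan polynomial is $$R_{\mathcal{G}_N}(Y,Z)=1+\sum_{n=1}^{N-1}Y^n\sum_{P=1}^{n}\binom{N-n+1}{P}\sum_{I=\epsilon(n)}^{P}Z^{n-I}\,\mathcal{C}_n(P,I)+Y^NZ^{N-\epsilon(N)},$$ where $\epsilon(q)=(1-(-1)^q)/2$ for $q\in\mathbb{N}$ and $\mathcal{C}_n(P,I)$ is the number of compositions of $n$ into $P$ positive integer parts among which exactly $I$ are odd. (ii) Let $\mathcal{G}^t_N$ be the $N$-twisted-petal flower. Then $$R_{\mathcal{G}^t_N}(Y,Z)=1+\sum_{n=1}^{N-1}Y^n\sum_{P=1}^{n}\binom{N-n+1}{P}\sum_{I=0}^{P}Z^{n-I}\,\mathcal{C}^t_n(P,I)+Y^NZ^{N-\epsilon_{(3)}(N)},$$ where $\epsilon_{(3)}(q)=1$ if $q\in 3\mathbb{N}+2$ and $\epsilon_{(3)}(q)=0$ otherwise, and $\mathcal{C}^t_n(P,I)$ is the number of compositions of $n$ into $P$ positive integer parts among which exactly $I$ belong to $3\mathbb{N}+2$.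
   Context: A ribbon graph is a surface with boundary presented as a union of discs called vertices and edges, vertices and edges meeting in disjoint line segments, each lying on the boundary of exactly one vertex and one edge, each edge containing exactly two such segments. A self-loop at vertex $v$ is twisted if $v\cup e$ is a Möbius band and untwisted if it is an annulus. For a ribbon graph $\mathcal{G}$, the Bollobás–Riordan polynomial (with the orientability variable set to $1$) is $R_{\mathcal{G}}(X,Y,Z)=\sum_{A}(X-1)^{r(\mathcal{G})-r(A)}Y^{n(A)}Z^{k(A)-F(A)+n(A)}$, the sum running over all spanning subgraphs $A$ of $\mathcal{G}$ (all vertices, any subset of edges), where $k(A)$ is the number of connected components, $r(A)=v(\mathcal{G})-k(A)$ the rank, $n(A)=|E(A)|-r(A)$ the nullity, and $F(A)$ the number of boundary components (faces) of $A$ viewed as a ribbon graph. For one-vertex graphs the rank is $0$ so the polynomial depends only on $Y,Z$. An $N$-petal flower is a one-vertex ribbon graph with self-loops $e_1,\dots,e_N$, $e_i$ having ends $a_i,b_i$ in the cyclic order $a_1,a_2,b_1,a_3,b_2,\dots,a_N,b_{N-1},b_N$ around the vertex (so consecutive petals interlace, non-consecutive ones do not). The $N$-untwisted-petal (resp. $N$-twisted-petal) flower is the one in which all petals are untwisted (resp. twisted). A composition of $n$ into $P$ parts is an ordered tuple $(q_1,\dots,q_P)$ of positive integers with sum $n$. Binomial coefficients $\binom{a}{b}$ with $b>a\ge 0$ are $0$. *)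

(* Defs.v *)
From HB Require Import structures.
From mathcomp Require Import all_boot all_order all_algebra.
From mathcomp Require Import mpoly.

Set Implicit Arguments.
Unset Strict Implicit.
Unset Printing Implicit Defensive.

Import GRing.Theory.
Local Open Scope ring_scope.

(* A ribbon graph, up to homeomorphism, encoded as a signed rotation system.
   The pairs (e, false) and (e, true) are the two ends of the edge-disc e, i.e.
   the two segments along which it is glued to vertex-discs.  [rot v] lists the
   ends met when running once around the boundary of the disc v in a chosen
   direction; only its cyclic order matters, and it is empty when v is isolated.
   [twisted e] tells whether e is glued incoherently with the chosen directions
   at its two ends; if e is a self-loop at v, this does not depend on the choice
   and says that v together with e is a Moebius band rather than an annulus. *)
Record ribbon_graph := RibbonGraph {
  vertex : finType;
  edge : finType;
  rot : vertex -> seq (edge * bool);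
  twisted : edge -> bool;
  rot_perm : perm_eq (flatten [seq rot v | v <- enum vertex])
                     (enum {: edge * bool})
}.

Section SpanningSubgraph.
Variables (G : ribbon_graph) (A : {set edge G}).

Definition sub_rot (v : vertex G) : seq (edge G * bool) :=
  [seq h <- rot v | h.1 \in A].

Definition adjacent : rel (vertex G) := fun u w =>
  [exists e in A, exists b, ((e, b) \in rot u) && ((e, ~~ b) \in rot w)].

Definition components : nat := n_comp adjacent predT.
Definition rank : nat := #|vertex G| - components.
Definition nullity : nat := #|A| - rank.

(* [(h, false)] and [(h, true)] are the initial and final points of the segment
   h with respect to the direction chosen on the boundary of its vertex. *)
Definition corner : finType := ((edge G * bool) * bool)%type.

(* p and q bound an arc of a vertex boundary that is free of edges of A. *)
Definition vertex_arc : rel corner := fun p q =>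
  [&& p.2, ~~ q.2 &
      [exists v, (p.1 \in sub_rot v) && (q.1 == next (sub_rot v) p.1)]].

(* p and q bound a free side of an edge: for coherent gluing, a side joins the
   initial point of one end to the final point of the other. *)
Definition edge_side : rel corner := fun p q =>
  [&& p.1.1 == q.1.1, p.1.2 != q.1.2 & (p.2 == q.2) == twisted p.1.1].

Definition boundary_arc : rel corner := fun p q =>
  [|| vertex_arc p q, vertex_arc q p | edge_side p q].

(* The second term counts the boundary circles of the vertex-discs that are
   isolated in A. *)
Definition faces : nat :=
  n_comp boundary_arc [pred p : corner | p.1.1 \in A]
  + #|[pred v | sub_rot v == [::]]|.

End SpanningSubgraph.

Definition varX : {mpoly int[3]} := 'X_(@Ordinal 3 0 isT).
Definition varY : {mpoly int[3]} := 'X_(@Ordinal 3 1 isT).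
Definition varZ : {mpoly int[3]} := 'X_(@Ordinal 3 2 isT).

(* The subtractions on nat in the exponents (and in [rank], [nullity]) are never
   truncated; in particular components A + nullity A - faces A is the Euler genus
   of A. *)
Definition bollobas_riordan (G : ribbon_graph) : {mpoly int[3]} :=
  \sum_(A : {set edge G})
     (varX - 1) ^+ (rank [set: edge G] - rank A)
     * varY ^+ nullity A
     * varZ ^+ (components A + nullity A - faces A).

(* The cyclic order a_0, a_1, b_0, a_2, b_1, ..., a_{N-1}, b_{N-2}, b_{N-1} with
   a_i = (i, false) and b_i = (i, true). *)
Definition flower_word (N : nat) : seq (nat * bool) :=
  (0%N, false)
    :: rcons (flatten [seq [:: (i.+1, false); (i, true)] | i <- iota 0 N.-1])
             (N.-1, true).

Definition to_end (N : nat) (h : nat * bool) : option ('I_N * bool) :=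
  omap (fun i => (i, h.2)) (insub h.1).

(* No entry of the word is dropped by [pmap] when 0 < N. *)
Definition flower_rot (N : nat) (_ : unit) : seq ('I_N * bool) :=
  pmap (@to_end N) (flower_word N).

Lemma to_endK (N : nat) :
  ocancel (@to_end N) (fun h : 'I_N * bool => (val h.1, h.2)).
Proof. by case=> i b; rewrite /to_end /=; case: insubP => //= j _ ->. Qed.

Lemma mem_flower_body (m : nat) (i : nat) (b : bool) :
  ((i, b) \in flatten [seq [:: (j.+1, false); (j, true)] | j <- iota 0 m])
    = (if b then i < m else 0 < i <= m)%N.
Proof.
apply/flatten_mapP/idP => [[j]|].
  rewrite mem_iota add0n !inE => /andP[_ ltjm] /orP[] /eqP[-> ->] //.
case: b => [ltim|/andP[i_gt0 leim]].
  by exists i; rewrite ?mem_iota ?add0n // !inE eqxx orbT.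
by exists i.-1; rewrite ?mem_iota ?add0n ?prednK // !inE eqxx.
Qed.

Lemma flower_word_uniq (N : nat) : uniq (flower_word N).
Proof.
rewrite /flower_word /= mem_rcons rcons_uniq inE !mem_flower_body ltnn /=.
rewrite xpair_eqE andbF ltnn /=.
elim: (N.-1) => // m IHm.
rewrite -[m.+1]addn1 iotaD map_cat flatten_cat cat_uniq IHm /=.
by rewrite !mem_flower_body add0n !ltnn !inE !xpair_eqE /= andbF.
Qed.

Lemma flower_rot_perm (N : nat) :
  perm_eq (flatten [seq flower_rot N v | v <- enum {: unit}])
          (enum {: 'I_N * bool}).
Proof.
rewrite enumT unlock /= cats0; apply: uniq_perm.
- by apply: (pmap_uniq (@to_endK N)); exact: flower_word_uniq.
- exact: enum_uniq.
case=> i b; rewrite mem_enum inE mem_pmap; apply/mapP.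
exists (val i, b); last by rewrite /to_end /= valK.
have N_gt0 : (0 < N)%N by apply: leq_ltn_trans (ltn_ord i).
have leiN : (i <= N.-1)%N by rewrite -ltnS prednK.
rewrite /flower_word inE mem_rcons inE mem_flower_body !xpair_eqE.
case: b; rewrite /= ?andbF ?andbT /= -?leq_eqVlt // leiN andbT.
by rewrite -leqn0 leqNgt; case: (0 < _)%N.
Qed.

(* All petals are twisted if [t], untwisted otherwise. *)
Definition petal_flower (t : bool) (N : nat) : ribbon_graph :=
  @RibbonGraph unit 'I_N (flower_rot N) (fun=> t) (flower_rot_perm N).

Definition in3N2 : pred nat := fun q => q == 2 %[mod 3].

Definition eps (q : nat) : nat := odd q.
Definition eps3 (q : nat) : nat := in3N2 q.

Lemma epsE (q : nat) : (eps q)%:R = (1 - (-1) ^+ q) / 2 :> rat.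
Proof. by rewrite /eps -signr_odd; case: odd. Qed.

(* Number of compositions of n into P parts, exactly I of which satisfy S; the
   parts of a composition of n are at most n, hence range over 'I_n.+1. *)
Definition compositions (S : pred nat) (n P I : nat) : nat :=
  #|[set q : P.-tuple 'I_n.+1 |
      [&& [forall j, 0 < tnth q j]%N,
          (\sum_(j < P) tnth q j)%N == n
        & #|[set j | S (tnth q j)]| == I]]|.

(* Main.v *)
(* Petals in A form runs of consecutive petals, and the number of boundary
   components of A is one more than the number of runs whose matrix over F_2,
   path adjacency plus t times the identity (t = 1 for twisted petals), is singular:
   runs of odd length for t = 0, of length 2 mod 3 for t = 1. Indeed the boundary
   components are counted through their 2-colourings: such a colouring amounts to
   the colour x at the base point and the set of edges across which the
   colour changes, and the two free sides of each edge impose exactly that this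
   set is in the kernel of the interlace matrix.
   The complement of an n-element A cuts it into N - n + 1 possibly empty runs, so
   the generating function of such A is the coefficient of X^n in
   (1 + Q)^(N - n + 1) = \sum_P 'C(N - n + 1, P) Q^P, where Q = \sum_(q > 0) g(q) X^q and
   g(q) is the weight of a run of length q; the coefficient of X^n in Q^P is the sum
   over compositions. *)
Require Import Defs.
From mathcomp Require Import all_boot all_order all_algebra.
From mathcomp Require Import mpoly zify.

Set Implicit Arguments.
Unset Strict Implicit.

Import GRing.Theory.
Local Open Scope nat_scope.

(** * Closed sets and connected components *)

Section Closed.
Variables (T : finType) (e : rel T).

Definition closed_set (B : {set T}) : bool :=
  [forall x, forall y, e x y ==> ((x \in B) == (y \in B))].

Lemma closed_setP (B : {set T}) : reflect (closed e B) (closed_set B).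
Proof.
apply: (iffP forallP) => [clB x y exy | clB x].
  by move: (clB x) => /forallP/(_ y)/implyP/(_ exy)/eqP.
by apply/forallP=> y; apply/implyP=> /clB ->.
Qed.

(** A closed set is a union of components, hence determined by the roots it contains. This turns
    counting boundary components into counting 2-colourings. *)
Lemma card_closed_subsets (a : {pred T}) : connect_sym e -> closed e a ->
  #|[set B : {set T} | (B \subset a) && closed_set B]| = 2 ^ n_comp e a.
Proof.
move=> sym_e cl_a.
have -> : n_comp e a = #|[set x in a | roots e x]|.
  by rewrite cardsE /n_comp_mem; apply: eq_card => x; rewrite !inE andbC.
rewrite -card_powerset.
pose spread (C : {set T}) := [set x | fingraph.root e x \in C].
have clP (B : {set T}) : closed_set B ->
    forall x, (fingraph.root e x \in B) = (x \in B).
  by move=> /closed_setP clB x; rewrite -(closed_connect clB (connect_root e x)).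
have spread_inj : {in powerset [set x in a | roots e x] &, injective spread}.
  move=> C D; rewrite !inE => /subsetP CA /subsetP DA /setP eqCD.
  apply/setP=> x; case rx: (roots e x).
    by move: (eqCD x); rewrite !inE (eqP rx).
  by apply/idP/idP => [/CA|/DA]; rewrite !inE rx andbF.
rewrite -(card_in_imset spread_inj); apply: eq_card => B; rewrite !inE.
apply/andP/imsetP => [[/subsetP BA clB]|[C]].
  exists (B :&: [set x | roots e x]).
    by rewrite inE; apply/subsetP=> x; rewrite !inE => /andP[/BA -> ->].
  by apply/setP=> x; rewrite !inE (roots_root sym_e) andbT clP.
rewrite inE => /subsetP CA ->; split.
  apply/subsetP=> x; rewrite inE => /CA; rewrite inE => /andP[+ _].
  by rewrite -(closed_connect cl_a (connect_root e x)).
apply/closed_setP => x y exy.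
by rewrite !inE (fingraph.rootP sym_e (connect1 exy)).
Qed.
End Closed.

(** * Colourings read along the vertex boundary *)

Section Trace.
Variable T : Type.

(* The boundary colour, read along the word w starting from x, is c h false
   before and c h true after each end h of P, and reaches x'. *)
Fixpoint trace (P : pred T) (c : T -> bool -> bool) (w : seq T) (x x' : bool) :=
  if w is h :: w' then
    if P h then (c h false == x) && trace P c w' (c h true) x'
    else trace P c w' x x'
  else x == x'.

Lemma trace_cat P c w1 w2 x x' :
  trace P c (w1 ++ w2) x x' =
    [exists y, trace P c w1 x y && trace P c w2 y x'].
Proof.
elim: w1 x => [|h w IH] x /=.
  apply/idP/existsP => [tr|[y /andP[/eqP-> //]]].
  by exists x; rewrite eqxx.
case: (P h); rewrite IH //; case: (c h false == x) => //=.
by symmetry; apply/negbTE/existsP => -[].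
Qed.

Lemma trace_filter P c w x x' :
  trace P c w x x' =
    if [seq h <- w | P h] is h :: s then
      [&& c h false == x, path (fun h h' => c h true == c h' false) h s
        & c (last h s) true == x']
    else x == x'.
Proof.
elim: w x => //= h w IH x; case: (P h); rewrite IH //=.
by case: filter => [|k s] //=; rewrite (eq_sym (c h true)) -!andbA.
Qed.

End Trace.

Lemma trace_pmap (T U : Type) (f : T -> option U) P c w x x' :
  trace P c (pmap f w) x x' =
  trace (fun h => oapp P false (f h)) (fun h s => oapp (c^~ s) false (f h)) w x x'.
Proof.
elim: w x => //= h w IH x; case: (f h) => //= k; by rewrite IH; case: (P k); rewrite ?IH.
Qed.

(** Cuts the cyclic order open at a base point, whose colour is [x]. If no end is in [P], both
    colours work. *)
Lemma cycle_trace (T : eqType) (P : pred T) (c : T -> bool -> bool) (w : seq T) :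
  cycle (fun h h' => c h true == c h' false) (filter P w) =
    [exists x, trace P c w x x].
Proof.
apply/idP/existsP => [|[x]]; last first.
  rewrite trace_filter; case: filter => //= h s /and3P[/eqP<- pth /eqP cx].
  by rewrite rcons_path pth cx /=.
case E: (filter P w) => [|h s] cyc.
  by exists true; rewrite trace_filter E.
exists (c h false); rewrite trace_filter E eqxx /=.
by move: cyc; rewrite /= rcons_path.
Qed.

(* Colouring of the arcs on the boundary of the flower determined by the colour x
   before a_0 and by the set of edges across which the colour changes, given by
   its characteristic sequence ys. *)
Definition init_colour (x : bool) (ys : seq bool) (h : nat * bool) : bool :=
  let z := nth false (false :: ys) in
  x (+) z h.1 (+) (h.2 && (z h.1 (+) z h.1.+1 (+) z h.1.+2)).

Lemma init_colour_false x ys k :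
  init_colour x ys (k.+1, false) = x (+) nth false ys k.
Proof. by rewrite /init_colour /= addbF. Qed.

Lemma init_colour_true x ys k :
  init_colour x ys (k, true) = x (+) nth false ys k (+) nth false ys k.+1.
Proof.
rewrite /init_colour /=.
case: x; case: (nth false (false :: ys) k);
by case: (nth false ys k); case: (nth false ys k.+1).
Qed.

(** Just before the pair a_(k+1), b_k only petal k is open, so the current colour is x + y_k. The
    pair opens petal k+1 and closes petal k, which preserves this invariant. *)
Lemma trace_flower_body (P : pred (nat * bool)) c x ys k m x' :
  (forall i b, P (i, b) -> c (i, b) true = c (i, b) false (+) nth false ys i) ->
  (forall i b, ~~ P (i, b) -> nth false ys i = false) ->
  trace P c (flatten [seq [:: (i.+1, false); (i, true)] | i <- iota k m])
     (x (+) nth false ys k) x' =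
  let ok h := P h ==> (c h false == init_colour x ys h) in
  [&& all (fun i => ok (i.+1, false) && ok (i, true)) (iota k m)
    & x (+) nth false ys (k + m) == x'].
Proof.
move=> cd ysP; cbv zeta; elim: m k => [|m IH] k; first by rewrite /= addn0.
rewrite [iota k m.+1]/= map_cons [flatten _]/= [LHS]/=.
rewrite /= addnS -addSn init_colour_false init_colour_true.
case P1: (P (k.+1, false)) => /=.
  case: eqP => //= e1; rewrite (cd _ _ P1) e1.
  case P2: (P (k, true)) => /=; last first.
    by rewrite -IH (ysP _ _ (negbT P2)) addbF.
  by rewrite (cd _ _ P2) -andbA -IH; case: eqP => //= ->; rewrite addbAC addbK.
rewrite (ysP _ _ (negbT P1)) !addbF.
case P2: (P (k, true)) => /=; last first.
  by rewrite -IH (ysP _ _ (negbT P1)) (ysP _ _ (negbT P2)).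
rewrite (cd _ _ P2) -andbA -IH (ysP _ _ (negbT P1)) addbF.
by case: eqP => //= ->; rewrite addbK.
Qed.

Lemma trace_flower N (P : pred (nat * bool)) c x ys : 0 < N -> size ys = N ->
  (forall i b, P (i, b) -> i < N) ->
  (forall i b, P (i, b) -> c (i, b) true = c (i, b) false (+) nth false ys i) ->
  (forall i b, ~~ P (i, b) -> nth false ys i = false) ->
  reflect (forall h, P h -> c h false = init_colour x ys h)
    (trace P c (flower_word N) x x).
Proof.
move=> N_gt0 szys PN cd ysP.
(* There is no petal N: the default value makes the last end b_(N-1) obey the general formula for
   b_i. *)
have nthN : nth false ys N = false by rewrite nth_default // szys.
rewrite /flower_word -cats1.
pose ok h := P h ==> (c h false == init_colour x ys h).
set body := flatten _.
have -> : trace P c ((0, false) :: body ++ [:: (N.-1, true)]) x x =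
  ok (0, false) && trace P c (body ++ [:: (N.-1, true)]) (x (+) nth false ys 0) x.
  rewrite [LHS]/= /ok /init_colour /= !addbF.
  case P0: (P _) => /=; last by rewrite (ysP _ _ (negbT P0)) addbF.
  by case: eqP => //= e; rewrite (cd _ _ P0) e.
rewrite trace_cat.
have lastE : trace P c [:: (N.-1, true)] (x (+) nth false ys N.-1) x = ok (N.-1, true).
  rewrite /ok /= init_colour_true prednK // nthN addbF.
  case PN1: (P _) => /=; last by rewrite (ysP _ _ (negbT PN1)) addbF eqxx.
  case: eqP => //= e; rewrite (cd _ _ PN1) e.
  by rewrite addbK eqxx.
have -> : [exists y, trace P c body (x (+) nth false ys 0) y
                      && trace P c [:: (N.-1, true)] y x] =
  all (fun i => ok (i.+1, false) && ok (i, true)) (iota 0 N.-1) && ok (N.-1, true).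
  apply/existsP/andP => [[y]|[al okN]].
    rewrite (trace_flower_body _ _ _ _ cd ysP) add0n => /andP[/andP[-> /eqP<-]].
    by rewrite lastE.
  exists (x (+) nth false ys N.-1).
  rewrite lastE okN (trace_flower_body _ _ _ _ cd ysP) add0n eqxx.
  by apply/andP; split=> //; apply/andP.
apply: (iffP and3P) => [[/implyP h0 /allP hb /implyP hN] [i b] Pib|H].
  have ltiN := PN _ _ Pib; apply/eqP.
  case: b Pib => Pib.
    case: (ltnP i N.-1) => ltiN1.
      have /hb/andP[_ /implyP] : i \in iota 0 N.-1 by rewrite mem_iota.
      exact.
    have eiN : i = N.-1 by lia.
    by rewrite eiN in Pib *; exact: hN.
  case: i Pib ltiN => [|i] Pib ltiN; first exact: h0.
  have /hb/andP[/implyP + _] : i \in iota 0 N.-1 by rewrite mem_iota; lia.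
  exact.
split; first by apply/implyP=> /H ->.
  by apply/allP=> i _; apply/andP; split; apply/implyP=> /H ->.
by apply/implyP=> /H ->.
Qed.

(** * Sums over tuples, and the kernel of the interlace matrix *)

Local Open Scope ring_scope.

Lemma big_tuple_cons (R : Type) (idx : R) (op : Monoid.com_law idx) (T : finType) n
    (F : n.+1.-tuple T -> R) :
  \big[op/idx]_s F s = \big[op/idx]_b \big[op/idx]_(s : n.-tuple T) F [tuple of b :: s].
Proof.
rewrite pair_big; apply: (reindex (fun bs : T * n.-tuple T => [tuple of bs.1 :: bs.2])).
exists (fun s : n.+1.-tuple T => (thead s, [tuple of behead s])) => [[b s]|s] _ /=.
  by congr pair; apply: val_inj.
by rewrite [RHS]tuple_eta; apply: val_inj.
Qed.

Lemma big_tuple_nil (R : Type) (idx : R) (op : Monoid.law idx) (T : finType)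
    (F : 0.-tuple T -> R) :
  \big[op/idx]_s F s = F [tuple].
Proof. by rewrite (big_pred1 [tuple]) // => s; apply/esym/eqP; exact: tuple0. Qed.

Local Open Scope nat_scope.

(* Lengths of the maximal blocks of true in nseq a true ++ s, including the empty
   blocks that are delimited by consecutive false. *)
Fixpoint runs (a : nat) (s : seq bool) : seq nat :=
  match s with
  | [::] => [:: a]
  | true :: s' => runs a.+1 s'
  | false :: s' => a :: runs 0 s'
  end.

Lemma sumn_runs a s : sumn (runs a s) = a + count id s.
Proof. by elim: s a => [|[] s IH] a /=; rewrite ?IH ?addn0 // addSnnS. Qed.

Definition bad_part (t : bool) : pred nat := if t then in3N2 else odd.

(* A kernel vector restricted to a run has entries b u_1, b u_2, ..., where u is
   [path_entry t], u_0 = 0 and u_1 = 1; a run of length q is singular iff u_(q+1) = 0. *)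
Definition path_entry (t : bool) (k : nat) : bool :=
  if t then ~~ (3 %| k) else odd k.

(** This is the kernel equation at a petal inside a run. *)
Lemma path_entry_rec t k :
  path_entry t k.+2 = path_entry t k (+) (t && path_entry t k.+1).
Proof.
rewrite /path_entry; case: t => /=; last by rewrite negbK addbF.
by rewrite /dvdn; lia.
Qed.

Lemma path_entry_bad t q : path_entry t q.+1 = ~~ bad_part t q.
Proof. by case: t; rewrite /path_entry /bad_part //= /in3N2 /dvdn; lia. Qed.

Lemma bad_part_leq t q : bad_part t q <= q.
Proof. by case: t; case: q => [|q] //=; apply: leq_trans (leq_b1 _) _. Qed.

Lemma count_bad_leq t r : count (bad_part t) r <= sumn r.
Proof. by elim: r => //= q r; apply: leq_add; apply: bad_part_leq. Qed.

(* s is the characteristic sequence of the subgraph, and p is the entry before ys. *)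
Definition kernel (t p : bool) (s ys : seq bool) : bool :=
  let z := nth false (p :: ys) in
  all (fun i => (nth false ys i ==> nth false s i)
        && (nth false s i ==> (z i == (t && z i.+1) (+) z i.+2)))
      (iota 0 (size s)).

Lemma kernel_cons t p b s y ys :
  kernel t p (b :: s) (y :: ys) =
  [&& y ==> b, b ==> (p == (t && y) (+) head false ys) & kernel t y s ys].
Proof. by rewrite /kernel /= (iotaDl 1 0) all_map andbA. Qed.

(** The previous entry [p] and the first entry [v] form the state of a transfer-matrix recursion
    along [s]. *)
Definition kernel_card t p v n s : nat :=
  \sum_(ys : n.-tuple bool) ((head false ys == v) && kernel t p s ys).

(** The equation of the first petal determines the next entry, p + t v. *)
Lemma kernel_card_true t p v n s :
  kernel_card t p v n.+1 (true :: s) = kernel_card t v (p (+) (t && v)) n s.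
Proof.
rewrite /kernel_card big_tuple_cons big_bool /= -big_split; apply: eq_bigr => ys _.
rewrite !kernel_cons /=.
case: (t); case: (p); case: v => //=; rewrite ?addn0 ?add0n ?add0b //;
by case: (head _ _).
Qed.

(** An absent petal forces the entry 0 and imposes no equation, so the next entry is free. *)
Lemma kernel_card_false t p v n s :
  kernel_card t p v n.+1 (false :: s) =
    ~~ v * (kernel_card t false false n s + kernel_card t false true n s).
Proof.
rewrite /kernel_card big_tuple_cons big_bool /= -!big_split big_distrr.
apply: eq_bigr => ys _.
rewrite !kernel_cons /=.
by case: v => //=; rewrite mul1n; case: (head false ys) => //=; rewrite addn0.
Qed.

(** After [a] petals of the current run, a partial solution is 0 or the path vector; these are the
    two summands. When the run ends, the second survives exactly if the run is bad, which doubles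
    the count. *)
Lemma kernel_card_runs t a s :
  kernel_card t false false (size s) s +
    kernel_card t (path_entry t a) (path_entry t a.+1) (size s) s =
  2 ^ count (bad_part t) (runs a s).
Proof.
elim: s a => [|[] s IH] a /=.
(* The head of the empty tuple defaults to false, so the end of [s] closes the last run as an absent
   petal would. *)
- rewrite /kernel_card !big_tuple_nil path_entry_bad /kernel /= addn0.
  by case: bad_part.
- by rewrite !kernel_card_true andbF addbF -path_entry_rec IH.
rewrite !kernel_card_false mul1n path_entry_bad expnD -(IH 0) negbK.
have -> : path_entry t 0 = false by rewrite /path_entry; case: (t).
have -> : path_entry t 1 = true by rewrite /path_entry; case: (t).
by case: bad_part; rewrite ?mul1n ?addn0 // addnn mul2n.
Qed.

Lemma card_kernel t n (s : n.-tuple bool) :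
  #|[set ys : n.-tuple bool | kernel t false s ys]| = 2 ^ count (bad_part t) (runs 0 s).
Proof.
rewrite -kernel_card_runs size_tuple -big_split /=.
have -> : path_entry t 0 = false by rewrite /path_entry; case: (t).
have -> : path_entry t 1 = true by rewrite /path_entry; case: (t).
rewrite -sum1_card big_mkcond; apply: eq_bigr => ys _.
by rewrite inE; case: head; case: kernel.
Qed.

(** * Boundary components of a subgraph of the flower *)

Lemma uniq_flower_rot N v : uniq (flower_rot N v).
Proof. exact: (pmap_uniq (@to_endK N)) (flower_word_uniq N). Qed.

Lemma mem_flower_rot N v h : h \in flower_rot N v.
Proof.
have := perm_mem (flower_rot_perm N) h; rewrite mem_enum enumT unlock /= cats0.
by case: v => ->.
Qed.

Lemma components_flower t N (A : {set edge (petal_flower t N)}) : components A = 1.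
Proof.
rewrite /components /n_comp_mem -[RHS]card_unit; apply: eq_card => -[].
by rewrite [LHS]andbT /= /roots unfold_in /=; case: fingraph.root.
Qed.

Section FlowerFaces.
Variables (t : bool) (N : nat) (N_gt0 : 0 < N) (s : N.-tuple bool).
Let G := petal_flower t N.
Let A : {set edge G} := [set i : 'I_N | tnth s i].

Lemma connect_sym_boundary : connect_sym (@boundary_arc G A).
Proof.
apply: sym_connect_sym => p q; rewrite /boundary_arc orbCA; congr [|| _, _ | _].
rewrite /edge_side eq_sym [p.1.2 == _]eq_sym [p.2 == _]eq_sym.
by case: eqP => // ->.
Qed.

Lemma closed_boundary : closed (@boundary_arc G A) [pred p : corner G | p.1.1 \in A].
Proof.
have va p q : @vertex_arc G A p q -> (p.1.1 \in A) = (q.1.1 \in A).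
  case/and3P=> _ _ /existsP[v /andP[pv /eqP qv]].
  have : q.1 \in sub_rot A v by rewrite qv mem_next.
  by move: pv; rewrite !mem_filter => /andP[h1 _] /andP[h2 _]; exact: etrans h1 (esym h2).
move=> p q; rewrite -[p \in _]/(p.1.1 \in A) -[q \in _]/(q.1.1 \in A).
by case/or3P=> [/va|/va|/and3P[/eqP->]].
Qed.

Definition corner_colour (B : {set corner G}) (h : edge G * bool) (q : bool) : bool :=
  (h, q) \in B.

Definition rot_trace (B : {set corner G}) (x : bool) : bool :=
  trace (fun h : edge G * bool => h.1 \in A) (corner_colour B) (flower_rot N tt) x x.

(** The two conditions express invariance along the vertex arcs and along the free sides of the
    edges. *)
Lemma boundary_closedP (B : {set corner G}) :
  reflect ((exists x, rot_trace B x)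
     /\ (forall i b q, ((i, b, q) \in B) = ((i, ~~ b, t (+) ~~ q) \in B)))
   (closed_set (@boundary_arc G A) B).
Proof.
pose glued h h' := corner_colour B h true == corner_colour B h' false.
have cycE : (exists x, rot_trace B x) <-> cycle glued (@sub_rot G A tt).
  by rewrite cycle_trace; split=> [/existsP|/existsP].
have us : uniq (@sub_rot G A tt) by apply: filter_uniq; apply: uniq_flower_rot.
apply: (iffP (closed_setP _ _)) => [cl|[/cycE cyc eB] p q].
  split; last first.
    move=> i b q; apply: cl; rewrite /boundary_arc /edge_side /= eqxx /=.
    by apply/or3P/Or33; case: (t); case: b; case: q.
  apply/cycE; apply: cycle_from_next us _ => h hs; apply/eqP; apply: cl.
  apply/or3P/Or31; rewrite /vertex_arc /=; apply/existsP; exists tt.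
  by rewrite hs /=.
have va u v : @vertex_arc G A u v -> (u \in B) = (v \in B).
  case: u v => u ub [v vb] /and3P[/= -> /negbTE-> /existsP[[] /andP[ps /eqP->]]].
  by have /eqP := next_cycle cyc ps.
case/or3P=> [/va -> // | /va -> // |].
case: p q => [[i b] x] [[j b'] y] /and3P[/= /eqP<- bb' xy]; rewrite eB.
congr (_ \in B).
by move: bb' xy; rewrite /=; case: (t); case: b; case: b'; case: x; case: y.
Qed.

Definition flower_colouring (xys : bool * N.-tuple bool) : {set corner G} :=
  [set p : corner G | (p.1.1 \in A) &&
     (let i := val (p.1.1 : 'I_N) in
      init_colour xys.1 xys.2 (i, p.1.2) (+) (p.2 && nth false xys.2 i))].

(** Transports [trace_flower] from ends indexed by numbers to ends indexed by ordinals. *)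
Lemma trace_flower_rot B x ys :
  size ys = N ->
  (forall (i : 'I_N) b, i \in A ->
     corner_colour B (i, b) true = corner_colour B (i, b) false (+) nth false ys i) ->
  (forall (i : 'I_N), i \notin A -> nth false ys i = false) ->
  reflect (forall (i : 'I_N) b, i \in A ->
             corner_colour B (i, b) false = init_colour x ys (val i, b))
    (rot_trace B x).
Proof.
move=> szys cd ysA; rewrite /rot_trace /flower_rot trace_pmap.
have E (i : nat) b : to_end N (i, b) = if insub i is Some j then Some (j, b) else None.
  by rewrite /to_end /=; case: insub.
apply: (iffP (trace_flower _ N_gt0 szys _ _ _)).
- by move=> i b; rewrite E; case: insubP.
- move=> i b; rewrite E; case: insubP => //= j ltiN <-; exact: cd.
- move=> i b; rewrite E; case: insubP => [j ltiN <-|]; first exact: ysA.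
  by rewrite -leqNgt => leNi _; rewrite nth_default // szys.
- move=> H i b iA; have := H (val i, b); rewrite E valK /=; exact.
- move=> H [i b]; rewrite E; case: insubP => //= j _ <-; exact: H.
Qed.

(** Both free sides of petal i give the same equation y_(i-1) + t y_i + y_(i+1) = 0, which is row i
    of the kernel condition. *)
Lemma flower_colouring_closed x (ys : N.-tuple bool) : kernel t false s ys ->
  closed_set (@boundary_arc G A) (flower_colouring (x, ys)).
Proof.
move=> /allP ker; apply/boundary_closedP; split.
  exists x; apply/(@trace_flower_rot (flower_colouring (x, ys)) x ys).
  - exact: size_tuple.
  - move=> i b iA; rewrite /corner_colour !inE /= !(tnth_nth false) in iA *.
    by rewrite iA addbF.
  - move=> i; rewrite inE (tnth_nth false).
    have /ker/andP[/implyP + _] : val i \in iota 0 (size s).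
      by rewrite mem_iota size_tuple /=.
    by move=> H ni; apply: contraNF ni.
  - move=> i b iA; rewrite /corner_colour !inE /= !(tnth_nth false) in iA *.
    by rewrite iA addbF.
move=> i b q; rewrite !inE /=; case iA: (tnth s i) => //=.
have /ker/andP[_] : val i \in iota 0 (size s) by rewrite mem_iota size_tuple /=.
rewrite -[nth false s _]tnth_nth iA /= /init_colour /= => /eqP->.
case: x; case: (t); case: b; case: q; case: (nth _ _ _); case: (nth _ _ _); by [].
Qed.

(** The colour changes are visible at the petals of [A], and any one of these reveals [x]. Without
    petals both values of [x] would give the empty set. *)
Lemma flower_colouring_inj : 0 < #|A| ->
  {in setX [set: bool] [set ys : N.-tuple bool | kernel t false s ys] &,
    injective flower_colouring}.
Proof.
case/card_gt0P=> i0; rewrite inE => i0A.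
move=> [x ys] [x' ys']; rewrite !inE /= => /allP ker /allP ker' /setP eqB.
have eqc (i : 'I_N) q : tnth s i ->
  init_colour x ys (val i, false) (+) (q && nth false ys i)
   = init_colour x' ys' (val i, false) (+) (q && nth false ys' i).
  by move=> iA; have := eqB (i, false, q); rewrite !inE /= iA.
have eys : ys = ys'.
  apply: eq_from_tnth => i.
  case iA: (tnth s i).
    have := eqc i false iA; have := eqc i true iA.
    rewrite !(tnth_nth false) /= !addbF => + e; rewrite e; exact: addbI.
  have /ker/andP[+ _] : val i \in iota 0 (size s) by rewrite mem_iota size_tuple /=.
  have /ker'/andP[+ _] : val i \in iota 0 (size s) by rewrite mem_iota size_tuple /=.
  by rewrite -!tnth_nth iA !implybF => /negbTE-> /negbTE->.
rewrite -eys in eqc *; congr pair.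
have := eqc i0 false i0A; rewrite /init_colour /= !addbF; exact: addIb.
Qed.

Lemma flower_colouring_surj (B : {set corner G}) :
  B \subset [pred p : corner G | p.1.1 \in A] ->
  closed_set (@boundary_arc G A) B ->
  exists2 xys : bool * N.-tuple bool, kernel t false s xys.2 & B = flower_colouring xys.
Proof.
move=> /subsetP BA /boundary_closedP[[x tr] eB].
(* The change across a_i; the side equations make the change across b_i equal to it. *)
pose y (i : 'I_N) :=
  tnth s i && (((i, false, false) \in B) (+) ((i, false, true) \in B)).
pose ys := [tuple y i | i < N].
have ysE (i : 'I_N) : nth false ys i = y i.
  by rewrite -(tnth_nth false) tnth_mktuple.
have cd (i : 'I_N) b : i \in A ->
    corner_colour B (i, b) true = corner_colour B (i, b) false (+) nth false ys i.
  rewrite inE /corner_colour ysE /y => -> /=.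
  case: b; rewrite ?(eB i true) /=; case: (t) => /=; do 2!case: (_ \in B) => //=.
move/(trace_flower_rot x (size_tuple ys) cd): tr => tr.
have {}tr (i : 'I_N) b : i \in A ->
    corner_colour B (i, b) false = init_colour x ys (val i, b).
  by apply: tr => j; rewrite inE ysE /y => /negbTE->.
exists (x, ys); last first.
  apply/setP=> -[[i b] q]; rewrite inE /=.
  case: (boolP (i \in A)) => iA; last by apply: contraNF iA => /BA.
  by rewrite -tr //; case: q => /=; rewrite -?cd ?addbF.
apply/allP=> k; rewrite mem_iota size_tuple /= add0n => ltkN.
pose i := Ordinal ltkN; have -> : k = val i by [].
rewrite -[nth false s _]tnth_nth; apply/andP; split.
  by rewrite ysE /y; apply/implyP => /andP[].
apply/implyP => iA.
have iA' : i \in A by rewrite inE.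
have := eB i false false; move: (tr i false iA') (tr i true iA') (cd i true iA').
rewrite /corner_colour => -> e1 e2.
case: (t); rewrite /= ?e2 e1 /init_colour /=.
  by case: (x); case: (nth _ (_ :: _) _); case: (nth _ _ _); case: (nth _ _ _).
by case: (x); case: (nth _ (_ :: _) _); case: (nth _ _ _); case: (nth _ _ _).
Qed.

(** If [A] is nonempty, the closed sets correspond to pairs of a base colour and a kernel vector;
    the base colour accounts for the successor. If [A] is empty, the only face is the boundary of
    the isolated vertex. *)
Lemma faces_flower : faces A = (count (bad_part t) (runs 0 s)).+1.
Proof.
rewrite /faces.
have -> : #|[pred v : vertex G | sub_rot A v == [::]]| = (#|A| == 0).
  transitivity (#|[pred v : unit | #|A| == 0]|); last first.
    case: (#|A| == 0); first by rewrite -[RHS]card_unit; apply: eq_card.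
    by rewrite -[RHS](card0 unit); apply: eq_card.
  apply: eq_card => v; rewrite !inE; apply/eqP/eqP => [e|/card0_eq A0].
    apply: eq_card0 => i; apply/negP => iA.
    have : (i, true) \in @sub_rot G A v by rewrite mem_filter iA mem_flower_rot.
    by rewrite e.
  apply/eqP; rewrite -[_ == _]negbK -has_filter -all_predC.
  by apply/allP=> h _ /=; rewrite A0.
have cl := card_closed_subsets connect_sym_boundary closed_boundary.
case: posnP => [A0|A_gt0]; last first.
  rewrite addn0; apply/eqP; rewrite -(eqn_exp2l _ _ (isT : 1 < 2)) -cl expnS -card_kernel.
  rewrite -[X in X * _]card_bool -cardsT -cardsX.
  rewrite -(card_in_imset (flower_colouring_inj A_gt0)).
  apply/eqP/eq_card => B; rewrite inE; apply/andP/imsetP.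
    move=> [BA clB]; have [[x ys] ker ->] := flower_colouring_surj BA clB.
    by exists (x, ys); rewrite // !inE.
  move=> [[x ys]]; rewrite !inE /= => ker ->; split; last exact: flower_colouring_closed.
  by apply/subsetP=> p; rewrite !inE => /andP[].
have -> : count (bad_part t) (runs 0 s) = 0.
  apply/eqP; rewrite -leqn0; apply: leq_trans (count_bad_leq _ _) _.
  rewrite sumn_runs add0n leqn0 -leqn0 leqNgt -has_count; apply/negP => /hasP[b].
  case/tnthP=> i -> si; move/card0_eq/(_ i): A0; by rewrite inE si.
rewrite addn1; congr S; apply/eqP; rewrite -(eqn_exp2l _ _ (isT : 1 < 2)) -cl.
rewrite expn0; apply/eqP; rewrite -(cards1 (set0 : {set corner G})); apply: eq_card => B.
have A0' p : p \in [pred p : corner G | p.1.1 \in A] = false by rewrite inE (card0_eq A0).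
rewrite !inE.
apply/andP/eqP => [[/subsetP BA _]|->].
  by apply/setP=> p; rewrite inE; apply/negP=> /BA; rewrite A0'.
split; first by apply/subsetP=> p; rewrite inE.
by apply/closed_setP=> p q _; rewrite !inE.
Qed.
End FlowerFaces.

(** * Generating functions for run lengths and compositions *)

Local Open Scope ring_scope.

Section RunSeries.
Variables (R : comNzRingType) (g : nat -> R).

(** The [m] absent petals leave a first run of length a + q and [m] further independent runs. Any
    truncation degree [K] above [n] gives the same coefficients. *)
Lemma sum_prod_runs K N m n a : N = (m + n)%N -> (n < K)%N ->
  \sum_(s : N.-tuple bool | count id s == n) \prod_(q <- runs a s) g q =
  \sum_(q < n.+1) g (a + q)%N * ((\poly_(q < K) g q) ^+ m)`_(n - q).
Proof.
set P := \poly_(_ < _) _.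
elim: N m n a => [|N IH] m n a eN ltnK.
  have [-> ->] : m = 0%N /\ n = 0%N by lia.
  by rewrite big_mkcond big_tuple_nil /= big_seq1 big_ord1 addn0 expr0 coef1 mulr1.
rewrite big_mkcond big_tuple_cons big_bool /= -!big_mkcond /=.
(* A first letter true lengthens the first run (q > 0); a first letter false ends it (q = 0). *)
rewrite big_ord_recl addn0 subn0 [RHS]addrC; congr (_ + _).
  case: n eN ltnK => [|n] eN ltnK; first by rewrite big_ord0 big_pred0.
  rewrite (eq_bigl (fun s : N.-tuple bool => count id s == n)) //.
  rewrite (IH m n) ?(ltnW ltnK) //; last by lia.
  by apply: eq_bigr => q _; rewrite lift0 addSnnS subSS.
under eq_bigr do rewrite big_cons.
rewrite -big_distrr /=; case: m eN => [|m] eN.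
  rewrite big_pred0 ?mulr0 => [|s].
    by rewrite expr0 coef1 -[n in n == _]add0n -eN mulr0.
  apply/negbTE; rewrite neq_ltn; apply/orP; left.
  by rewrite -[n in (_ < n)%N]add0n -eN ltnS -[X in (_ <= X)%N](size_tuple s) count_size.
rewrite (IH m n 0%N) //; last by lia.
congr (_ * _); rewrite exprS coefM; apply: eq_bigr => q _.
by rewrite add0n coef_poly (leq_ltn_trans _ ltnK) // -ltnS.
Qed.

Lemma coef_expr_run_series N n : (n <= N)%N ->
  \sum_(s : N.-tuple bool | count id s == n) \prod_(q <- runs 0 s) g q =
  ((\poly_(q < n.+1) g q) ^+ (N - n).+1)`_n.
Proof.
move=> leqnN; rewrite (@sum_prod_runs n.+1 N (N - n) n) ?subnK //.
rewrite exprS coefM; apply: eq_bigr => q _.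
by rewrite add0n coef_poly ltn_ord.
Qed.

(** Serves to replace the binomial range 0..m by 1..n, whichever of the two bounds is larger. *)
Lemma sum_nat_support (f : nat -> R) a b c :
  (a <= b)%N -> (forall i, ~~ (a <= i < b)%N -> f i = 0) ->
  (forall i, (c <= i)%N -> f i = 0) ->
  \sum_(0 <= i < c) f i = \sum_(a <= i < b) f i.
Proof.
move=> leab f0 fc.
have f_big k l : (forall i, (k <= i < l)%N -> f i = 0) -> \sum_(k <= i < l) f i = 0.
  by move=> f_kl; rewrite big_nat big1.
transitivity (\sum_(0 <= i < maxn b c) f i).
  rewrite [RHS](@big_cat_nat _ _ _ c) ?leq_maxr //= (f_big c) ?addr0 // => i /andP[ci _].
  exact: fc.
rewrite (@big_cat_nat _ _ _ a) ?leq_max ?leab //= f_big ?add0r => [|i /andP[_ lt]].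
  rewrite (@big_cat_nat _ _ _ b) ?leq_maxl //= (f_big b) ?addr0 // => i /andP[lei _].
  by apply: f0; rewrite [(i < b)%N]ltnNge lei andbF.
by apply: f0; rewrite [(a <= i)%N]leqNgt lt.
Qed.

Lemma coef_expr_composition m n : g 0%N = 1 -> (0 < n)%N ->
  ((\poly_(q < n.+1) g q) ^+ m)`_n =
  \sum_(1 <= P < n.+1) 'C(m, P)%:R * (('X * \poly_(q < n) g q.+1) ^+ P)`_n.
Proof.
move=> g0 n_gt0.
have -> : \poly_(q < n.+1) g q = 1 + 'X * \poly_(q < n) g q.+1.
  apply/polyP => -[|q]; rewrite coefD coefXM coef_poly coef1 /= ?g0 ?addr0 //.
  by rewrite coef_poly add0r ltnS.
set Q := 'X * _; rewrite exprDn coef_sum.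
rewrite -(big_mkord xpredT (fun i => (1 ^+ (m - i) * Q ^+ i *+ 'C(m, i))`_n)).
under eq_bigr do rewrite expr1n mul1r coefMn -mulr_natl.
(* The term P = 0 vanishes since n > 0, and those with P > n since X^P divides Q^P. *)
apply: sum_nat_support => // i; last by move=> ?; rewrite bin_small // mul0r.
case: i => [_|i]; first by rewrite expr0 coef1 eqn0Ngt n_gt0 mulr0.
by rewrite /= ltnS -leqNgt => leni; rewrite /Q exprMn coefXnM ltnS leni mulr0.
Qed.
End RunSeries.

Lemma sum_bad_compositions (R : comNzRingType) (z : R) (S : pred nat) n P :
  (forall q, S q <= q)%N ->
  (('X * \poly_(q < n) z ^+ (q.+1 - S q.+1)) ^+ P)`_n =
  \sum_(0 <= I < P.+1) z ^+ (n - I) * (compositions S n P I)%:R.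
Proof.
move=> S_le.
(* Weight of a part; the value 0 at q = 0 discards tuples with a zero part once the power is
   expanded by distributivity. *)
pose c (q : nat) := if (0 < q)%N then z ^+ (q - S q) else 0.
have -> : 'X * \poly_(q < n) z ^+ (q.+1 - S q.+1) = \sum_(q < n.+1) c q *: 'X^q.
  rewrite -(poly_def _ (fun q => c q)).
  by apply/polyP => -[|q]; rewrite coefXM !coef_poly.
pose nS (q : P.-tuple 'I_n.+1) := #|[set j | S (tnth q j)]|.
pose comp (q : P.-tuple 'I_n.+1) :=
  [forall j, (0 < tnth q j)%N] && ((\sum_(j < P) tnth q j)%N == n).
transitivity (\sum_(q | comp q) z ^+ (n - nS q)).
  rewrite -[P in X in X = _]card_ord -prodr_const bigA_distr_bigA coef_sum /=.
  rewrite (reindex (fun q : P.-tuple 'I_n.+1 => [ffun j => tnth q j])) /=; last first.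
    exists (fun f : {ffun 'I_P -> 'I_n.+1} => mktuple f) => [q|f] _.
      by apply: eq_from_tnth => j; rewrite tnth_mktuple ffunE.
    by apply/ffunP=> j; rewrite ffunE tnth_mktuple.
  rewrite [RHS]big_mkcond; apply: eq_bigr => q _; rewrite /comp.
  under eq_bigr do rewrite ffunE.
  rewrite scaler_prod prodrXr coefZ coefXn eq_sym.
  case: (boolP [forall j, _]) => [/forallP q_gt0|]; last first.
    rewrite negb_forall => /existsP[j]; rewrite -eqn0Ngt => /eqP qj0.
    by rewrite (bigD1 j) //= /c qj0 /= !mul0r.
  case: eqP => [en|_]; last by rewrite mulr0.
  rewrite mulr1; under eq_bigr do rewrite /c q_gt0.
  rewrite prodrXr sumnB // en; congr (_ ^+ (_ - _)).
  rewrite /nS -sum1_card [RHS]big_mkcond.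
  by apply: eq_bigr => j _; rewrite inE; case: (S _).
rewrite big_mkord.
have nS_lt q : (nS q < P.+1)%N by rewrite ltnS -[X in (_ <= X)%N]card_ord max_card.
rewrite (partition_big (fun q => Ordinal (nS_lt q)) xpredT) //=.
apply: eq_bigr => I _; rewrite /compositions -sum1_card natr_sum big_distrr /=.
apply: eq_big => [q|q /andP[_ /eqP<-]]; last by rewrite mulr1.
by rewrite inE -andbA.
Qed.

(** * The polynomial of the flower *)

Lemma compositions_odd_eps n P I : (I < eps n)%N -> compositions odd n P I = 0%N.
Proof.
rewrite /eps; case on: (odd n); last by [].
case: I => // _; apply: eq_card0 => q; rewrite inE.
apply/negP => /and3P[_ /eqP en /eqP/card0_eq nS].
move: on; rewrite -en (big_morph odd oddD (erefl : odd 0 = false)) big1 // => j _.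
by have := nS j; rewrite inE.
Qed.

Lemma prod_runs_bad (R : comNzRingType) (z : R) t s :
  \prod_(q <- runs 0 s) z ^+ (q - bad_part t q) =
  z ^+ (count id s - count (bad_part t) (runs 0 s)).
Proof.
rewrite prodrXr sumnB => [|q _]; last exact: bad_part_leq.
rewrite -sumnE sumn_runs add0n; congr (_ ^+ (_ - _)).
by rewrite -sum1_count [RHS]big_mkcond; apply: eq_bigr => q _; case: bad_part.
Qed.

Lemma card_set_tuple N (s : N.-tuple bool) : #|[set i | tnth s i]| = count id s.
Proof.
rewrite -sum1_card -sum1_count big_tuple.
by apply: eq_bigl => i; rewrite inE.
Qed.

(** Here k(A) = 1, r(A) = 0 and F(A) is one more than the number of bad runs, so the exponent of Z
    is additive over the runs. *)
Lemma bollobas_riordan_flower_runs t N : (0 < N)%N ->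
  bollobas_riordan (petal_flower t N) =
  \sum_(0 <= n < N.+1) varY ^+ n *
    \sum_(s : N.-tuple bool | count id s == n)
      \prod_(q <- runs 0 s) varZ ^+ (q - bad_part t q).
Proof.
move=> N_gt0; rewrite /bollobas_riordan.
have rk A : @rank (petal_flower t N) A = 0%N.
  by rewrite /rank components_flower card_unit.
rewrite (reindex (fun s : N.-tuple bool => [set i | tnth s i])) /=; last first.
  exists (fun A : {set 'I_N} => [tuple i \in A | i < N]) => [s|A] _.
    by apply: eq_from_tnth => i; rewrite tnth_mktuple inE.
  by apply/setP=> i; rewrite inE tnth_mktuple.
rewrite big_mkord.
have count_lt (s : N.-tuple bool) : (count id s < N.+1)%N.
  by rewrite ltnS -[X in (_ <= X)%N](size_tuple s) count_size.
rewrite (partition_big (fun s => Ordinal (count_lt s)) xpredT) //=.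
apply: eq_bigr => n _; rewrite big_distrr /=; apply: eq_big => // s /eqP<-.
rewrite prod_runs_bad /nullity !rk !subn0 expr0 mul1r card_set_tuple.
by rewrite components_flower (faces_flower _ N_gt0) add1n subSS.
Qed.

Lemma bollobas_riordan_flower t N : (0 < N)%N ->
  bollobas_riordan (petal_flower t N) =
    1 + \sum_(1 <= n < N) varY ^+ n *
          (\sum_(1 <= P < n.+1) 'C(N - n + 1, P)%:R *
             (\sum_(0 <= I < P.+1)
                varZ ^+ (n - I) * (compositions (bad_part t) n P I)%:R))
      + varY ^+ N * varZ ^+ (N - bad_part t N).
Proof.
move=> N_gt0; rewrite bollobas_riordan_flower_runs //.
have bad0 : bad_part t 0 = false by case: (t).
(* The extreme terms are split off: for n = 0 all runs are empty, for n = N there is a single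
   run. *)
rewrite big_nat_recr //= big_ltn // expr0 mul1r.
congr (_ + _ + _).
- rewrite coef_expr_run_series // subn0 (_ : \poly_(_ < 1) _ = 1) ?expr1n ?coef1 //.
  by apply/polyP=> -[|i]; rewrite coef_poly coef1 // bad0 subn0.
- apply: eq_big_nat => n /andP[n_gt0 ltnN]; congr (_ * _).
  rewrite coef_expr_run_series ?(ltnW ltnN) // coef_expr_composition ?bad0 //.
  rewrite addn1; apply: eq_bigr => P _; congr (_ * _).
  by rewrite sum_bad_compositions // => q; exact: bad_part_leq.
by rewrite coef_expr_run_series // subnn expr1 coef_poly ltnSn.
Qed.

Theorem theorem2 (N : nat) (hN : (1 <= N)%N) :
  bollobas_riordan (petal_flower false N) =
    1 + \sum_(1 <= n < N) varY ^+ n *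
          (\sum_(1 <= P < n.+1) 'C(N - n + 1, P)%:R *
             (\sum_(eps n <= I < P.+1)
                varZ ^+ (n - I) * (compositions odd n P I)%:R))
      + varY ^+ N * varZ ^+ (N - eps N)
  /\
  bollobas_riordan (petal_flower true N) =
    1 + \sum_(1 <= n < N) varY ^+ n *
          (\sum_(1 <= P < n.+1) 'C(N - n + 1, P)%:R *
             (\sum_(0 <= I < P.+1)
                varZ ^+ (n - I) * (compositions in3N2 n P I)%:R))
      + varY ^+ N * varZ ^+ (N - eps3 N).
Proof.
split; rewrite bollobas_riordan_flower //.
congr (_ + _ + _); apply: eq_bigr => n _; congr (_ * _).
rewrite !big_nat; apply: eq_bigr => P /andP[P_gt0 _]; congr (_ * _).
(* The terms below [eps n] vanish: an odd [n] needs at least one odd part. *)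
rewrite (@big_cat_nat _ _ _ (eps n)) //=; last first.
  by rewrite (leq_trans (leq_b1 _)).
rewrite big_nat big1 ?add0r // => I /andP[_ ltI].
by rewrite compositions_odd_eps // mulr0.
Qed.
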